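(* Let $\alpha\in\bar{\mathbb{Q}}$ and define $\alpha_0=\alpha$, $\alpha_n=H(\alpha_{n-1})$ for $n\in\mathbb{N}$. Then either there exist $N,a\in\mathbb{N}$ and rational $b>0$ such that $\alpha_n=a^b$ for all $n\ge N$, or $\lim_{n\to\infty}\alpha_n=1$.
   Context: $\bar{\mathbb{Q}}$ is the algebraic closure of $\mathbb{Q}$ in $\mathbb{C}$. $H:\bar{\mathbb{Q}}\to\bar{\mathbb{Q}}\cap[1,\infty)$ is the absolute multiplicative Weil height: for $\alpha$ of degree $d$ with $a_0>0$ the leading coefficient of a minimal polynomial of $\alpha$ in $\mathbb{Z}[t]$ and conjugates $\alpha_1,\dots,\alpha_d$, $H(\alpha)=\big(a_0\prod_i\max\{1,|\alpha_i|\}\big)^{1/d}$. $a^b$ denotes the positive real power. *)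

(* Defs.v *)
From HB Require Import structures.
From mathcomp Require Import all_boot all_order all_algebra all_field.
From Stdlib Require Import ClassicalEpsilon.
Set Implicit Arguments. Unset Strict Implicit. Unset Printing Implicit Defensive.
Import Order.TTheory GRing.Theory Num.Theory.
Local Open Scope ring_scope.

(* h is the absolute multiplicative Weil height of x: p is the minimal
   polynomial of x in Z[t] (primitive, irreducible over Q, positive leading
   coefficient a0), rs lists its complex roots (the conjugates of x, with
   multiplicity), d = deg p, and h = (a0 * prod_i max(1,|x_i|))^(1/d)
   (the positive real d-th root). *)
(* n-th root in algC (the nonnegative one on nonnegative reals) *)
Definition rootC (n : nat) (x : algC) : algC := n.-root x.

Definition is_weil_height (x h : algC) : Prop :=
  exists (p : {poly int}) (rs : seq algC),
    [/\ irreducible_poly (map_poly (intr : int -> rat) p),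
        zcontents p = 1 /\ 0 < lead_coef p,
        root (map_poly (intr : int -> algC) p) x,
        map_poly (intr : int -> algC) p
          = (lead_coef p)%:~R *: \prod_(r <- rs) ('X - r%:P)
      & h = rootC (size p).-1
              ((lead_coef p)%:~R * \prod_(r <- rs) Num.max 1 `|r|)].

(* The Weil height H : Qbar -> Qbar (the value specified above, which is
   uniquely determined). *)
Definition weilH (x : algC) : algC :=
  epsilon (inhabits (1 : algC)) (is_weil_height x).

Definition natrpow (a : nat) (b : rat) : algC :=
  rootC `|denq b|%N ((a%:R : algC) ^ numq b).

(* Main.v *)
(** Fix a Galois extension L of Q in C containing alpha, with group G of order g.
    For an algebraic integer x in L, every conjugate of x occurs equally often
    among the s(x), s in G, so H(x)^g = prod_s max(1,|s(x)|).  This product is,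
    up to sign, the product of the s(x) of modulus > 1 (that product is real
    because the conjugates are stable under complex conjugation), so it is again
    an integer of L, and it dominates the modulus of each of its conjugates.
    As H(b^m) = H(b)^m, it follows that each b = alpha_n with n >= 2 satisfies
    b^m = x for some m > 0 and some integer x of L dominating its conjugates.
    - If all |s(x)| >= 1, then H(b)^(mg) is |Norm x|, a natural number, and H
      fixes every positive root of a positive natural number.
    - Otherwise one factor max(1,|s(x)|) is 1 and the others are at most x, so
      alpha_(n+1)^g <= alpha_n^(g-1).  If this happens for all n >= 2, then
      alpha_n tends to 1.
    For the first step one uses that a0 * prod_(|r|>1) r, over the roots r of the
    minimal polynomial of alpha in Z[t], is an algebraic integer. *)
Require Import Defs.
From HB Require Import structures.
From mathcomp Require Import all_boot all_order all_algebra all_field.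
From mathcomp Require Import zify ring.
From Stdlib Require Import ClassicalEpsilon Classical.
Set Implicit Arguments. Unset Strict Implicit. Unset Printing Implicit Defensive.
Import Order.TTheory GRing.Theory Num.Theory.
Local Open Scope ring_scope.

Local Notation QtoC := (ratr : rat -> algC).
Local Notation pQtoC := (map_poly (ratr : rat -> algC)).
Local Notation pZtoQ := (map_poly (intr : int -> rat)).
Local Notation pZtoC := (map_poly (intr : int -> algC)).

(** * Irreducible rational polynomials and their complex roots *)

Lemma pZtoQtoC p : pQtoC (pZtoQ p) = pZtoC p.
Proof. by rewrite -map_poly_comp; apply: eq_map_poly => b; rewrite /= rmorph_int. Qed.

(** The minimal polynomial of z over Q divides both p and q, and it is associate to the irreducible
    p. *)
Lemma irredp_dvdp_root (p q : {poly rat}) (z : algC) :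
  irreducible_poly p -> root (pQtoC p) z -> root (pQtoC q) z -> p %| q.
Proof.
move=> [_ irr_p]; have [r [Dr _] min_r] := minCpolyP z.
rewrite !min_r => r_p r_q; have r_gt1 : size r != 1%N.
  by rewrite -(size_map_poly QtoC r) -Dr neq_ltn size_minCpoly orbT.
by rewrite -(eqp_dvdl _ (irr_p r r_gt1 r_p)).
Qed.

(** Induction on the degree: a root of q is a root of p, so p divides q and can be cancelled.
    Applied to the product of the X - s(x), this shows that all conjugates occur equally often. *)
Lemma irredp_power_roots (p q : {poly rat}) :
    irreducible_poly p -> p \is monic -> q \is monic ->
    (forall z : algC, root (pQtoC q) z -> root (pQtoC p) z) ->
  exists e, q = p ^+ e.
Proof.
move=> irr_p mon_p; have [n] := ubnP (size q).
elim: n q => // n IHn q ltqn mon_q roots_q.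
have [q_le1 | q_gt1] := leqP (size q) 1.
  exists 0%N; rewrite expr0; apply/eqP; rewrite -eqp_monic ?monic1 //.
  rewrite -size_poly_eq1 eqn_leq q_le1 lt0n size_poly_eq0.
  exact: monic_neq0.
have [z qz] : exists z, root (pQtoC q) z.
  by apply/closed_rootP; rewrite size_map_poly neq_ltn q_gt1 orbT.
have /dvdpP[r Dq] := irredp_dvdp_root irr_p (roots_q z qz) qz.
have mon_r : r \is monic by rewrite -(monicMr _ mon_p) -Dq.
have sz_q : size q = (size r + size p).-1.
  by rewrite Dq size_Mmonic ?monic_neq0.
have [||e De] := IHn r _ mon_r.
- have := irr_p.1; have := monic_neq0 mon_r; rewrite -size_poly_gt0.
  by move: sz_q ltqn; move: (size p) (size r) (size q) => a b c; lia.
- by move=> y ry; apply: roots_q; rewrite Dq rmorphM rootM ry.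
by exists e.+1; rewrite Dq De exprSr.
Qed.

(** * Products over lists of roots, and the factor max(1, |r|) *)

Lemma prod_flatten_nseq (e : nat) (s : seq algC) (F : algC -> algC) :
  \prod_(r <- flatten (nseq e s)) F r = (\prod_(r <- s) F r) ^+ e.
Proof. by rewrite big_flatten big_nseq -Monoid.iteropE. Qed.

(* [Num.max] on algC is a test for the partial order; [1] and [`|r|] are real,
   hence comparable. *)
Definition max1 (r : algC) : algC := Num.max 1 `|r|.

Lemma max1_cases r : (`|r| <= 1 /\ max1 r = 1) \/ (1 < `|r| /\ max1 r = `|r|).
Proof.
rewrite /max1; have [le_r1 | lt1r] := real_leP (normr_real r) (real1 _).
  by left.
by right.
Qed.

Lemma max1_ge1 r : 1 <= max1 r.
Proof. by case: (max1_cases r) => -[lt1r ->] //; apply: ltW. Qed.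

Lemma max1_gt0 r : 0 < max1 r.
Proof. exact: lt_le_trans ltr01 (max1_ge1 r). Qed.

Lemma max1_ge0 r : 0 <= max1 r. Proof. exact/ltW/max1_gt0. Qed.

Lemma norm_le_max1 r : `|r| <= max1 r.
Proof. by case: (max1_cases r) => -[? ->]. Qed.

Lemma max1X r m : max1 (r ^+ m) = max1 r ^+ m.
Proof.
rewrite {1}/max1 normrX; case: (max1_cases r) => -[r1 ->].
  by rewrite expr1n max_l // exprn_ile1.
by rewrite max_r // exprn_ege1 // ltW.
Qed.

Lemma prod_max1_ge1 (I : Type) (s : seq I) (P : pred I) F :
  1 <= \prod_(i <- s | P i) max1 (F i).
Proof. by elim/big_ind: _ => // [a b|i _]; [apply: mulr_ege1 | apply: max1_ge1]. Qed.

(** * Existence of the height *)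

(** This makes [epsilon] return an actual height. The polynomial p is the primitive part of the
    minimal polynomial over Q after clearing denominators. *)
Lemma weil_height_exists x : exists h, is_weil_height x h.
Proof.
have [r [Dr mon_r] min_r] := minCpolyP x.
have [q [a nz_a Dq]] := rat_poly_scale r.
have nz_q : q != 0.
  by apply: contraTneq mon_r => q0; rewrite Dq q0 raddf0 scaler0 monicE lead_coef0 eq_sym oner_eq0.
pose p := zprimitive q; have Dr_p : r %= pZtoQ p.
  rewrite Dq (eqp_ltrans (eqp_scale _ _)) ?invr_eq0 ?intr_eq0 //.
  rewrite [X in pZtoQ X]zpolyEprim map_polyZ /= (eqp_ltrans (eqp_scale _ _)) ?eqpxx //.
  by rewrite intr_eq0 zcontents_eq0.
have nz_p : p != 0 by rewrite zprimitive_eq0.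
have root_r : root (pQtoC r) x by rewrite min_r.
have [rs Drs] := closed_field_poly_normal (pZtoC p).
exists (Defs.rootC (size p).-1 ((lead_coef p)%:~R * \prod_(r <- rs) Num.max 1 `|r|)).
exists p, rs; split=> //.
- have irr_r : irreducible_poly r.
    split=> [|d d_neq1 dv_dr]; first by rewrite -(size_map_poly QtoC) -Dr size_minCpoly.
    have /dvdpP[e De] := dv_dr; have: root (pQtoC (e * d)) x by rewrite -De.
    rewrite rmorphM rootM !min_r => /orP[dv_re | dv_rd]; last by rewrite /eqp dv_dr.
    case/negP: d_neq1; rewrite -dvdp1.
    have nz_e : e != 0 by apply: contraTneq (monic_neq0 mon_r) => e0; rewrite De e0 mul0r eqxx.
    by rewrite -(dvdp_mul2l _ _ nz_e) mulr1 -De.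
  have [r_gt1 irr] := irr_r; split=> [|d d_neq1]; first by rewrite -(eqp_size Dr_p).
  by rewrite -(eqp_dvdr _ Dr_p) => /irr-/(_ d_neq1)/eqp_trans; apply.
- split; first by rewrite zcontents_primitive nz_q.
  by rewrite -sgz_gt0 sgz_lead_primitive nz_q.
- by rewrite -pZtoQtoC -dvdp_XsubCl -(eqp_dvdr _ (_ : pQtoC r %= _)) ?eqp_map ?dvdp_XsubCl.
by rewrite Drs lead_coef_map_inj //; apply: intr_inj.
Qed.

Lemma weilHP x : is_weil_height x (weilH x).
Proof. exact: (epsilon_spec _ _ (weil_height_exists x)). Qed.

(** By Gauss's lemma, p divides in Z[t] the minimal polynomial of the algebraic integer x, which is
    monic; so [lead_coef p] divides 1. *)
Lemma primitive_lead_Aint (p : {poly int}) x :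
    irreducible_poly (pZtoQ p) -> zcontents p = 1 -> 0 < lead_coef p ->
    root (pZtoC p) x -> x \in Aint ->
  lead_coef p = 1.
Proof.
move=> irr_p p1 p_gt0 px /floorpP[pz Dpz].
have mon_pz : lead_coef pz = 1.
  apply: (@intr_inj algC); have := minCpoly_monic x.
  rewrite Dpz monicE lead_coef_map_inj // => [/eqP-> //|].
  exact: intr_inj.
have: pZtoQ p %| pZtoQ pz.
  apply: (@irredp_dvdp_root _ _ x) => //; rewrite pZtoQtoC //.
  by rewrite -Dpz root_minCpoly.
rewrite dvdp_rat_int => /dvdpP_int[r].
have -> : zprimitive p = p by rewrite [RHS]zpolyEprim p1 scale1r.
move=> /(congr1 lead_coef); rewrite lead_coefM mon_pz => lead1.
have : (lead_coef p %| 1)%Z by apply/dvdzP; exists (lead_coef r); rewrite mulrC.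
by rewrite dvdz1 => /eqP lead_abs; rewrite -(gtz0_abs p_gt0) lead_abs.
Qed.

(** * Conjugates in a Galois extension of Q *)

Section NormalField.

Variables (L : splittingFieldType rat) (iota : {rmorphism L -> algC}).
Local Notation gal := (gal_of {:L}).

Lemma galois_rat : galois 1 {:L}.
Proof.
apply/and3P; split; first exact: sub1v.
  apply/separableP=> y _; apply: pcharf0_separable => n.
  by rewrite -[RHS](pchar_num rat) pchar_lalg.
exact: normalFieldf.
Qed.

Lemma fixed_rat (x : L) : (forall s : gal, s x = x) -> iota x \in Crat.
Proof.
move=> fix_x; suffices /vlineP[a ->]: x \in 1%VS.
  by rewrite rmorphZ_num rmorph1 mulr1 Crat_rat.
rewrite -(galois_fixedField galois_rat); apply/fixedFieldP; first exact: memvf.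
by move=> s _; apply: fix_x.
Qed.

Definition embeddings (x : L) : seq algC := [seq iota (s x) | s : gal <- enum [set: gal]].

Lemma big_embeddings (R : Type) (idx : R) (op : Monoid.com_law idx) x F :
  \big[op/idx]_(y <- embeddings x) F y = \big[op/idx]_(s : gal) F (iota (s x)).
Proof. by rewrite big_map big_enum; apply: eq_bigl => s; rewrite inE. Qed.

Lemma mem_embeddings x (s : gal) : iota (s x) \in embeddings x.
Proof. by apply: map_f; rewrite mem_enum inE. Qed.

Lemma mem_embeddings1 x : iota x \in embeddings x.
Proof. by rewrite -{1}(gal_id {:L} x) mem_embeddings. Qed.

Lemma embeddingsP x z : reflect (exists s : gal, z = iota (s x)) (z \in embeddings x).
Proof.
apply: (iffP mapP) => [[s _ ->] | [s ->]]; first by exists s.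
by exists s; rewrite ?mem_enum ?inE.
Qed.

(** Applying t in G permutes the factors X - s(x), so G fixes every coefficient of their product. *)
Lemma embeddings_poly_rat (x : L) :
  exists2 q : {poly rat}, q \is monic &
    \prod_(y <- embeddings x) ('X - y%:P) = pQtoC q.
Proof.
pose p := \prod_(s : gal) ('X - (s x)%:P).
have Dp : map_poly iota p = \prod_(y <- embeddings x) ('X - y%:P).
  rewrite big_embeddings rmorph_prod /=.
  by apply: eq_bigr => s _; rewrite map_polyXsubC.
have rat_p i : (map_poly iota p)`_i \in Crat.
  rewrite coef_map; apply: fixed_rat => t; rewrite -coef_map.
  rewrite rmorph_prod /= /p [in RHS](reindex_inj (mulIg t)) /=.
  congr (polyseq _)`_i; apply: eq_bigr => s _.
  by rewrite rmorphB /= map_polyX map_polyC galM ?memvf.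
have DQ : pQtoC (map_poly getCrat (map_poly iota p)) = map_poly iota p.
  (* The value at 0 matters for the coefficients of [map_poly] beyond the degree. *)
  have getCrat0 : getCrat 0 = 0 by apply: (fmorph_inj QtoC); rewrite rmorph0; apply: getCratK Crat0.
  by apply/polyP=> i; rewrite coef_map /= coef_map_id0 // getCratK.
exists (map_poly getCrat (map_poly iota p)); rewrite -?Dp ?DQ //.
by rewrite -(map_monic QtoC) DQ map_monic monic_prod_XsubC.
Qed.

(** As p shares the root [iota x] with the rational polynomial whose roots are [embeddings x], it
    divides that polynomial. *)
Lemma conjugate_embeddings (p : {poly rat}) x z :
    irreducible_poly p -> root (pQtoC p) (iota x) -> root (pQtoC p) z ->
  z \in embeddings x.
Proof.
move=> irr_p px pz; have [q _ Dq] := embeddings_poly_rat x.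
rewrite -root_prod_XsubC Dq.
have /dvdpP[r ->]: p %| q.
  by apply: irredp_dvdp_root irr_p px _; rewrite -Dq root_prod_XsubC mem_embeddings1.
by rewrite rmorphM rootM pz orbT.
Qed.

Lemma root_embedding (p : {poly rat}) x (s : gal) :
  root (pQtoC p) (iota x) -> root (pQtoC p) (iota (s x)).
Proof.
have <- : map_poly iota (map_poly (in_alg L) p) = pQtoC p.
  rewrite -map_poly_comp; apply: eq_map_poly => a.
  by rewrite /= rmorphZ_num rmorph1 mulr1.
have fix_p : map_poly s (map_poly (in_alg L) p) = map_poly (in_alg L) p.
  by rewrite -map_poly_comp; apply: eq_map_poly => a; rewrite /= linearZ rmorph1.
by rewrite !fmorph_root -{2}fix_p fmorph_root.
Qed.

(** Here p is monic, and the product of the X - s(x) is a power p^e, so the s(x) are the roots of p,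
    each repeated e times. *)
Lemma weil_height_embeddings x h :
    iota x \in Aint -> is_weil_height (iota x) h ->
  h ^+ #|[set: gal]| = \prod_(s : gal) max1 (iota (s x)).
Proof.
move=> int_x [p [rs [irr_p [p1 p_gt0] px Dp ->]]].
have lead1 := primitive_lead_Aint irr_p p1 p_gt0 px int_x.
rewrite lead1 scale1r in Dp; rewrite lead1 mul1r /Defs.rootC.
have [q mon_q Dq] := embeddings_poly_rat x.
have mon_p : pZtoQ p \is monic.
  by rewrite monicE lead_coef_map_inj ?lead1 //; apply: intr_inj.
have [y|e De] := irredp_power_roots irr_p mon_p mon_q.
  rewrite -Dq root_prod_XsubC => /embeddingsP[s ->].
  by apply: root_embedding; rewrite pZtoQtoC.
have /prod_XsubC_eq eq_rs : \prod_(y <- embeddings x) ('X - y%:P)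
    = \prod_(y <- flatten (nseq e rs)) ('X - y%:P).
  by rewrite Dq De rmorphXn /= pZtoQtoC Dp big_flatten big_nseq -Monoid.iteropE.
have sz_p : size p = (size rs).+1.
  by rewrite -(size_rat_int_poly p) -(size_map_poly QtoC) pZtoQtoC Dp size_prod_XsubC.
(* Comparing the lengths of the two lists of roots gives |G| = e deg p. *)
have -> : #|[set: gal]| = (size rs * e)%N.
  rewrite cardE -(size_map (fun s : gal => iota (s x))) (perm_size eq_rs).
  by rewrite size_flatten /shape map_nseq sumn_nseq.
rewrite -(big_embeddings _ x max1) (perm_big _ eq_rs) prod_flatten_nseq sz_p.
rewrite exprM rootCK //.
by have := irr_p.1; rewrite size_rat_int_poly sz_p.
Qed.

End NormalField.

Lemma splitting_field_exists (x : algC) :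
  exists (L : splittingFieldType rat) (iota : {rmorphism L -> algC}) (y : L),
    iota y = x.
Proof.
have [r [Dr mon_r] min_r] := minCpolyP x.
have [s Ds] := closed_field_poly_normal (pQtoC r).
have [Qs [QsC [s1 Ds1 gen_s1]]] := num_field_exists s.
have splitQs : SplittingField.axiom Qs.
  exists (map_poly (in_alg Qs) r).
    by apply/polyOverP=> i; rewrite coef_map memvZ ?mem1v.
  exists s1 => //; rewrite -(eqp_map QsC) -map_poly_comp.
  rewrite (eq_map_poly (g := QtoC)) => [|a]; last by rewrite /= rmorphZ_num rmorph1 mulr1.
  rewrite Ds lead_coef_map (monicP mon_r) rmorph1 scale1r -Ds1 big_map rmorph_prod /=.
  by rewrite (eq_bigr _ (fun z _ => map_polyXsubC QsC z)) eqpxx.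
pose splitM := FieldExt_isSplittingField.Build rat Qs splitQs.
pose L : splittingFieldType rat := HB.pack Qs splitM.
have: x \in s.
  rewrite -root_prod_XsubC -[X in root X]scale1r -(rmorph1 QtoC) -(monicP mon_r).
  by rewrite -lead_coef_map -Ds min_r.
rewrite -Ds1 => /mapP[y _ Dx].
by exists L, QsC, y.
Qed.

(** * Algebraic integers as roots and coefficients of polynomials *)

Lemma AintP x : x \in Aint -> integralOver (intr : int -> algC) x.
Proof.
move=> int_x; have /floorpP[p Dp] := int_x; exists p; last by rewrite -Dp root_minCpoly.
rewrite monicE -(inj_eq (@intr_inj algC)) -lead_coef_map_inj //; last exact: intr_inj.
by rewrite -Dp (monicP (minCpoly_monic x)).
Qed.

Lemma integral_Aint x : integralOver (intr : int -> algC) x -> x \in Aint.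
Proof.
case=> p mon_p px; apply: root_monic_Aint px _ _; first exact: monic_map.
by apply/polyOverP=> i; rewrite coef_map /= intr_int.
Qed.

Lemma root_monic_polyOver_Aint (p : {poly algC}) x :
  p \is monic -> p \is a polyOver Aint -> root p x -> x \in Aint.
Proof.
move=> mon_p int_p px; apply/integral_Aint/(integral_root_monic mon_p px).
by move=> c /(allP int_p)/AintP.
Qed.

(* a r is a root of a^(n-1) f(X/a), which is monic when f has degree n and
   leading coefficient a. *)
Lemma lead_coefM_root_Aint (f : {poly algC}) r :
  f \is a polyOver Aint -> root f r -> lead_coef f * r \in Aint.
Proof.
move=> int_f fr; have [-> | nz_f] := eqVneq f 0; first by rewrite lead_coef0 mul0r Aint0.
have [k sz_f] : exists k, size f = k.+2.
  have := root_size_gt1 nz_f fr; case: (size f) => [|[|k]] // _; by exists k.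
set a := lead_coef f; have Da : f`_k.+1 = a by rewrite /a lead_coefE sz_f.
pose g := \poly_(i < k.+2) (if i == k.+1 then 1 else f`_i * a ^+ (k - i)).
have mon_g : g \is monic by rewrite monicE lead_coef_poly ?eqxx ?oner_eq0.
apply: (root_monic_polyOver_Aint mon_g).
  apply/polyOverP=> i; rewrite coef_poly; case: ifP => _; last exact: rpred0.
  case: ifP => _; first exact: rpred1.
  by rewrite rpredM ?rpredX ?(polyOverP int_f) // -Da (polyOverP int_f).
rewrite rootE horner_poly; apply/eqP.
transitivity (a ^+ k * f.[r]); last by rewrite (rootP fr) mulr0.
rewrite horner_coef sz_f mulr_sumr; apply: eq_bigr => i _ /=.
case: eqP => [-> | /eqP i_neq]; first by rewrite Da mul1r exprMn exprS; ring.
have le_ik : (i <= k)%N by have := ltn_ord i; lia.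
move: (nat_of_ord i) le_ik => j le_jk.
by rewrite exprMn -[in RHS](subnK le_jk) exprD; ring.
Qed.

(* Peeling off the leading term a X^n of q changes ('X - r) q by
   a X^(n+1) - a r X^n, whose coefficients are integral because a r is. *)
Lemma polyOver_Aint_divXsubC (q : {poly algC}) r :
  ('X - r%:P) * q \is a polyOver Aint -> q \is a polyOver Aint.
Proof.
have [n] := ubnP (size q); elim: n q => // n IHn q ltqn int_f.
have [-> | nz_q] := eqVneq q 0; first exact: rpred0.
set f := _ * q in int_f; set a := lead_coef q.
have Da : lead_coef f = a by rewrite lead_coefM lead_coefXsubC mul1r.
have int_a : a \in Aint by rewrite -Da (polyOverP int_f).
have int_ar : a * r \in Aint.
  by rewrite -Da lead_coefM_root_Aint // /f rootM root_XsubC eqxx.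
pose q' := q - a *: 'X^((size q).-1).
have sz_q' : (size q' < size q)%N.
  rewrite -[X in (_ < X)%N]prednK ?size_poly_gt0 // ltnS; apply/leq_sizeP => j le_j.
  rewrite coefB coefZ coefXn; case: eqVneq => [-> | j_neq]; first by rewrite mulr1 subrr.
  rewrite nth_default ?mulr0 ?subrr //.
  by move: le_j j_neq; case: (size q) => //= m; rewrite leq_eqVlt eq_sym => /predU1P[->|]; rewrite ?eqxx.
rewrite -[q](subrK (a *: 'X^((size q).-1))) -/q' rpredD //; last first.
  by rewrite polyOverZ // polyOverXn.
apply: IHn; first exact: leq_trans sz_q' _.
rewrite mulrBr -/f rpredB //.
have -> : ('X - r%:P) * (a *: 'X^((size q).-1)) = a *: 'X^((size q).-1.+1) - (a * r) *: 'X^((size q).-1).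
  by rewrite mulrBl -!mul_polyC polyCM exprS; ring.
by rewrite rpredB ?polyOverZ ?polyOverXn.
Qed.

(** Dividing out the factors X - r with r outside P keeps the coefficients integral; the constant
    coefficient that remains is the claimed number up to sign. *)
Lemma Aint_lead_prod (a : algC) (s : seq algC) (P : pred algC) :
    a *: \prod_(r <- s) ('X - r%:P) \is a polyOver Aint ->
  a * \prod_(r <- s | P r) r \in Aint.
Proof.
have drop t g : \prod_(r <- t) ('X - r%:P) * g \is a polyOver Aint -> g \is a polyOver Aint.
  elim: t => [|r t IHt]; first by rewrite big_nil mul1r.
  by rewrite big_cons -mulrA => /polyOver_Aint_divXsubC/IHt.
rewrite (bigID (predC P)) /= scalerAr -[X in X * _]big_filter => /drop.
under eq_bigl do rewrite negbK.
rewrite -big_filter -[in X in _ -> X]big_filter => /polyOverP/(_ 0%N).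
rewrite coefZ coef0_prod_XsubC mulrCA => int_c.
rewrite -[_ * _](signrMK (size [seq r <- s | P r])).
by rewrite rpredM // rpredX // rpredN1.
Qed.

(** * The product of the roots of modulus above 1 *)

Lemma prod_max1 (s : seq algC) :
  \prod_(r <- s) max1 r = `|\prod_(r <- s | 1 < `|r|) r|.
Proof.
rewrite normr_prod [RHS]big_mkcond; apply: eq_bigr => r _.
case: (max1_cases r) => -[r1 ->]; last by rewrite r1.
by rewrite le_gtF.
Qed.

(** Complex conjugation permutes the roots of a rational polynomial and preserves moduli, so the
    product on the right is real and equals its modulus up to sign. *)
Lemma prod_max1_sign (s : seq algC) (q : {poly rat}) :
    \prod_(r <- s) ('X - r%:P) = pQtoC q ->
  exists e : bool, \prod_(r <- s) max1 r = (-1) ^+ e * \prod_(r <- s | 1 < `|r|) r.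
Proof.
move=> Dq; have perm_s : perm_eq (map Num.conj s) s.
  apply/prod_XsubC_eq; rewrite big_map.
  transitivity (map_poly (Num.conj : algC -> algC) (\prod_(r <- s) ('X - r%:P))).
    by rewrite rmorph_prod; apply: eq_bigr => r _; rewrite /= map_polyXsubC.
  by rewrite Dq -map_poly_comp; apply: eq_map_poly => a; rewrite /= fmorph_rat.
rewrite prod_max1 real_normrEsign; first by eexists.
apply/CrealP; rewrite rmorph_prod /= -[RHS](perm_big _ perm_s) big_map.
by apply: eq_bigl => r; rewrite norm_conjC.
Qed.

(** * Elementary properties of the height *)

Lemma weilH_ge1 x : 1 <= weilH x.
Proof.
have [p [rs [irr_p [_ p_gt0] _ _ ->]]] := weilHP x.
rewrite /Defs.rootC rootC_ge1; last by have := irr_p.1; rewrite size_rat_int_poly; case: (size p) => [|[]].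
apply: mulr_ege1; last exact: prod_max1_ge1.
by rewrite (ler_int _ 1) -gtz0_ge1.
Qed.

Lemma weilH_ge0 x : 0 <= weilH x.
Proof. exact: le_trans ler01 (weilH_ge1 x). Qed.

(** In a Galois extension containing x, the |G|-th powers of both sides agree factor by factor,
    since max(1, |r^m|) = max(1, |r|)^m. *)
Lemma weilH_natX (x : algC) m : x \in Aint -> weilH (x ^+ m) = weilH x ^+ m.
Proof.
move=> int_x; have [L [iota [y Dy]]] := splitting_field_exists x.
have := weilHP x; have := weilHP (x ^+ m).
rewrite -Dy -rmorphXn /= => hXm hX.
have g_gt0 : (0 < #|[set: gal_of {:L}]|)%N by rewrite cardsT; apply/card_gt0P; exists 1%g.
apply: (pexpIrn g_gt0); rewrite ?nnegrE ?exprn_ge0 ?weilH_ge0 //.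
rewrite exprAC (weil_height_embeddings _ hX) ?Dy // (weil_height_embeddings _ hXm).
  by rewrite -prodrXl; apply: eq_bigr => s _; rewrite !rmorphXn max1X.
by rewrite rmorphXn Dy rpredX.
Qed.

Lemma Aint_root (b : algC) m : (0 < m)%N -> b ^+ m \in Aint -> b \in Aint.
Proof.
move=> m_gt0 int_bm; apply: (@root_monic_polyOver_Aint ('X^m - (b ^+ m)%:P)).
- exact: monicXnsubC.
- by rewrite polyOverXnsubC.
by rewrite rootE !hornerE subrr.
Qed.

(** * One step of the iteration, inside a fixed Galois extension *)

Section HeightStep.

Variables (L : splittingFieldType rat) (iota : {rmorphism L -> algC}).
Local Notation gal := (gal_of {:L}).
Local Notation order_gal := #|[set: gal]|.

Lemma order_gal_gt0 : (0 < order_gal)%N.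
Proof. by rewrite cardsT; apply/card_gt0P; exists 1%g. Qed.

Lemma Aint_embedding (x : L) (s : gal) : iota x \in Aint -> iota (s x) \in Aint.
Proof.
move=> int_x; have [q [Dq mon_q] _] := minCpolyP (iota x).
apply: (@root_monic_Aint (minCpoly (iota x))); rewrite ?minCpoly_monic //.
by rewrite Dq root_embedding // -Dq root_minCpoly.
Qed.

(** In the partial order of [algC], this also forces [iota x] to be real and nonnegative. *)
Definition dominates_conjugates (x : L) := forall t : gal, `|iota (t x)| <= iota x.

Lemma height_product (x : L) : iota x \in Aint ->
  exists y, [/\ iota y = \prod_(s : gal) max1 (iota (s x)), iota y \in Aint
             & dominates_conjugates y].
Proof.
move=> int_x; have [q _ /prod_max1_sign[e]] := embeddings_poly_rat iota x.
have -> : \prod_(r <- embeddings iota x | 1 < `|r|) r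
    = \prod_(s : gal | 1 < `|iota (s x)|) iota (s x).
  by rewrite big_mkcond big_embeddings -big_mkcond.
rewrite big_embeddings => De.
pose y := (-1) ^+ e * \prod_(s : gal | 1 < `|iota (s x)|) s x.
have Dy : iota y = \prod_(s : gal) max1 (iota (s x)).
  by rewrite De rmorphM rmorph_sign rmorph_prod.
exists y; split=> // [|t].
  rewrite rmorphM rmorph_sign rmorph_prod rpredM ?rpred_sign //.
  by rewrite rpred_prod // => s _; apply: Aint_embedding.
rewrite Dy !rmorphM !rmorph_sign normrM normr_sign mul1r !rmorph_prod normr_prod /=.
(* Translate the index by t. Factors with |s(x)| > 1 are then compared one by one, and the remaining
   ones on the right are at least 1. *)
rewrite [leRHS](reindex_inj (mulIg t)) /= [leRHS](bigID (fun s : gal => 1 < `|iota (s x)|)) /=.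
apply: le_trans (_ : \prod_(s : gal | 1 < `|iota (s x)|) max1 (iota ((s * t)%g x)) <= _).
  apply: ler_prod => s _; rewrite normr_ge0 galM ?memvf //.
  exact: norm_le_max1.
by rewrite ler_peMr ?prod_max1_ge1 // (le_trans ler01) ?prod_max1_ge1.
Qed.

(** The product is the modulus of the norm of x, which is a rational algebraic integer. *)
Lemma height_product_nat (x : L) :
    iota x \in Aint -> (forall s : gal, 1 <= `|iota (s x)|) ->
  exists a : nat, \prod_(s : gal) max1 (iota (s x)) = a%:R.
Proof.
move=> int_x ge1_x; apply/natrP.
have -> : \prod_(s : gal) max1 (iota (s x)) = `|iota (\prod_(s : gal) s x)|.
  rewrite rmorph_prod normr_prod; apply: eq_bigr => s _.
  by case: (max1_cases (iota (s x))) => -[le1 ->] //; apply: le_anti; rewrite le1 ge1_x.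
apply: natr_norm_int; apply: Cint_rat_Aint.
  apply: fixed_rat => t; rewrite rmorph_prod [RHS](reindex_inj (mulIg t)) /=.
  by apply: eq_bigr => s _; rewrite galM ?memvf.
by rewrite rmorph_prod rpred_prod // => s _; apply: Aint_embedding.
Qed.

Lemma height_product_le (x : L) (s : gal) :
    dominates_conjugates x -> 1 <= iota x -> `|iota (s x)| < 1 ->
  \prod_(t : gal) max1 (iota (t x)) <= iota x ^+ order_gal.-1.
Proof.
move=> dom_x ge1_x lt1; rewrite (bigD1 s) //=.
have -> : max1 (iota (s x)) = 1.
  by case: (max1_cases (iota (s x))) => -[lt1r ->] //; rewrite (lt_gtF lt1) in lt1r.
rewrite mul1r cardsT -(cardC1 s) -prodr_const.
apply: ler_prod => t _; rewrite max1_ge0 /=.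
by case: (max1_cases (iota (t x))) => -[_ ->].
Qed.

(** With d = deg p, H(x)^d is up to sign a0 times the product of the roots of modulus above 1, an
    algebraic integer even when x is not. *)
Lemma weilH_start (x : L) :
  exists m y, [/\ (0 < m)%N, iota y \in Aint & weilH (iota x) ^+ m = iota y].
Proof.
have [p [rs [irr_p [_ p_gt0] px Dp ->]]] := weilHP (iota x).
have sz_p : size p = (size rs).+1.
  rewrite -(size_rat_int_poly p) -(size_map_poly QtoC) pZtoQtoC Dp size_scale ?size_prod_XsubC //.
  by rewrite intr_eq0 gt_eqF.
have rs_gt0 : (0 < size rs)%N by have := irr_p.1; rewrite size_rat_int_poly sz_p.
have /prod_max1_sign[e De] : \prod_(r <- rs) ('X - r%:P)
    = pQtoC ((lead_coef p)%:~R^-1 *: pZtoQ p).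
  rewrite map_polyZ /= pZtoQtoC Dp fmorphV rmorph_int scalerA mulVf ?scale1r //.
  by rewrite intr_eq0 gt_eqF.
(* All roots are conjugates of x, so they lift to L, and with them their products. *)
have [zs Dzs] : exists zs, rs = map iota zs.
  have: {subset rs <= embeddings iota x}.
    move=> r rs_r; apply: (conjugate_embeddings irr_p); rewrite pZtoQtoC //.
    by rewrite Dp rootZ ?root_prod_XsubC // intr_eq0 gt_eqF.
  elim: (rs) => [|r rs' IHrs] sub_rs; first by exists [::].
  have /embeddingsP[s ->] := sub_rs r (mem_head _ _).
  have [|zs ->] := IHrs; last by exists (s x :: zs).
  by move=> z rs_z; rewrite sub_rs // inE rs_z orbT.
exists (size p).-1, ((lead_coef p)%:~R * ((-1) ^+ e * \prod_(z <- zs | 1 < `|iota z|) z)).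
have Dy : iota ((lead_coef p)%:~R * ((-1) ^+ e * \prod_(z <- zs | 1 < `|iota z|) z))
    = (lead_coef p)%:~R * ((-1) ^+ e * \prod_(r <- rs | 1 < `|r|) r).
  by rewrite Dzs big_map !rmorphM rmorph_int rmorph_sign rmorph_prod.
rewrite sz_p Dy; split=> //.
  rewrite mulrCA rpredM ?rpred_sign // Aint_lead_prod // -Dp.
  by apply/polyOverP=> i; rewrite coef_map Aint_int.
by rewrite /Defs.rootC rootCK // -De.
Qed.

(** The product formula requires an element of L; it is applied to b^m and brought back to b by
    H(b^m) = H(b)^m. *)
Lemma weilH_root_step (b : algC) m x :
    (0 < m)%N -> b ^+ m = iota x -> iota x \in Aint ->
  weilH b ^+ (m * order_gal) = \prod_(s : gal) max1 (iota (s x)).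
Proof.
move=> m_gt0 Dbm int_x.
have int_b : b \in Aint by rewrite (Aint_root m_gt0) ?Dbm.
rewrite exprM -(weilH_natX m int_b) Dbm.
exact: weil_height_embeddings int_x (weilHP _).
Qed.

(** The invariant of the iteration. It speaks of a power of b because a height, being a root, may
    lie outside L. *)
Definition root_state (b : algC) :=
  exists m x, [/\ (0 < m)%N, b ^+ m = iota x, iota x \in Aint & dominates_conjugates x].

Lemma root_state_step (b : algC) m x :
    (0 < m)%N -> b ^+ m = iota x -> iota x \in Aint -> root_state (weilH b).
Proof.
move=> m_gt0 Dbm int_x; have [y [Dy int_y dom_y]] := height_product int_x.
exists (m * order_gal)%N, y; split=> //; first by rewrite muln_gt0 m_gt0 order_gal_gt0.
by rewrite Dy; apply: weilH_root_step.
Qed.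

(** The exponents in the second case depend on |G| but not on m, so repeated contractions have one
    common rate. *)
Lemma weilH_nat_or_contract (b : algC) :
    1 <= b -> root_state b ->
  (exists m a : nat, (0 < m)%N /\ weilH b ^+ m = a%:R)
  \/ weilH b ^+ order_gal <= b ^+ order_gal.-1.
Proof.
move=> ge1_b [m [x [m_gt0 Dbm int_x dom_x]]].
have Dh := weilH_root_step m_gt0 Dbm int_x.
have [/existsP[s lt1] | /existsPn ge1] := boolP [exists s : gal, `|iota (s x)| < 1].
  (* Compare m-th powers, which turns b into x. *)
  right; rewrite -(ler_pXn2r m_gt0) ?nnegrE ?exprn_ge0 ?weilH_ge0 ?(le_trans ler01) //.
  rewrite -exprM mulnC Dh exprAC Dbm (height_product_le dom_x _ lt1) //.
  by rewrite -Dbm exprn_ege1.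
left; have [|a Da] := height_product_nat int_x.
  by move=> s; have := ge1 s; rewrite real_ltNge ?normr_real ?real1 // negbK.
exists (m * order_gal)%N, a; rewrite Dh; split=> //.
by rewrite muln_gt0 m_gt0 order_gal_gt0.
Qed.

End HeightStep.

(** * Roots of natural numbers are fixed by the height *)

Lemma weilH_nat (a : nat) : (0 < a)%N -> weilH a%:R = a%:R.
Proof.
(* Any Galois extension would do here; 0 is an arbitrary choice. *)
move=> a_gt0; have [L [iota _]] := splitting_field_exists 0.
have ha : is_weil_height (iota a%:R) (weilH a%:R).
  by rewrite rmorph_nat; apply: weilHP.
apply: (pexpIrn (order_gal_gt0 L)); rewrite ?nnegrE ?weilH_ge0 ?ler0n //.
rewrite (weil_height_embeddings _ ha); last by rewrite rmorph_nat Aint_Cnat ?natr_nat.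
rewrite cardsT -prodr_const; apply: eq_bigr => s _.
by rewrite !rmorph_nat /max1 normr_nat max_r // ler1n.
Qed.

Lemma weilH_root_nat (b : algC) (m a : nat) :
  (0 < m)%N -> 1 <= b -> b ^+ m = a%:R -> weilH b = b.
Proof.
move=> m_gt0 ge1_b Dbm; have b_ge0 := le_trans ler01 ge1_b.
apply: (pexpIrn m_gt0); rewrite ?nnegrE ?weilH_ge0 //.
have int_b : b \in Aint by rewrite (Aint_root m_gt0) // Dbm Aint_Cnat ?natr_nat.
rewrite -(weilH_natX m int_b) Dbm weilH_nat // -(ltr0n algC) -Dbm exprn_gt0 //.
exact: lt_le_trans ltr01 ge1_b.
Qed.

Lemma natrpow_inv (m a : nat) (b : algC) :
  (0 < m)%N -> 0 <= b -> b ^+ m = a%:R -> natrpow a (m%:R^-1) = b.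
Proof.
move=> m_gt0 b_ge0 Dbm; rewrite /natrpow /Defs.rootC.
have m_neq0 : m%:Z != 0 by rewrite eqz_nat -lt0n.
rewrite -[m%:R]/(m%:Z%:~R : rat) denqVz //.
have -> : numq (m%:Z%:~R^-1) = 1.
  by rewrite -div1r -[1]/(1%:~R) coprimeq_num ?coprime1n // mulr1 gtr0_sg.
by rewrite expr1z -Dbm rootCpX // rootCK.
Qed.

(** * Convergence to 1 by contraction *)

(** For h > 0 this is (1 + 1/h)^n >= 1 + n/h > K, with denominators cleared. *)
Lemma expn_contract_lt (h n K : nat) : (K * h < n)%N -> (K * h ^ n < h.+1 ^ n)%N.
Proof.
have bernoulli : (h ^ n * (h + n) <= h.+1 ^ n * h)%N.
  elim: n => [|n IHn]; first by rewrite !expn0 addn0.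
  have := leq_mul (leqnn h.+1) IHn; rewrite !expnS; nia.
(* For h = 0 the hypothesis still gives n > 0, so 0^n = 0. *)
case: h bernoulli => [|h] bern ltKn; first by rewrite exp0n ?muln0 ?expn_gt0 //; lia.
rewrite -(ltn_pmul2r (ltn0Sn h)); apply: leq_trans bern.
have : (0 < h.+1 ^ n)%N by rewrite expn_gt0.
by move: (h.+1 ^ n)%N => e; nia.
Qed.

Lemma bernoulli (R : numDomainType) (x : R) n : 0 <= x -> 1 + x *+ n <= (1 + x) ^+ n.
Proof.
move=> x_ge0; elim: n => [|n IHn]; first by rewrite mulr0n addr0.
rewrite exprS; apply: le_trans (ler_wpM2l _ IHn); last by rewrite addr_ge0.
rewrite mulrDl mul1r mulrSr addrA lerD2l mulrDr mulr1 lerDl mulr_ge0 ?mulrn_wge0 //.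
Qed.

(** Iteration gives u_n^((h+1)^n) <= u_0^(h^n). If u_0 <= (1+eps)^K and u_n >= 1+eps, then (h+1)^n
    <= K h^n, which fails once n > K h. *)
Lemma contraction_limit (u : nat -> algC) (h : nat) :
    (forall n, 1 <= u n) -> (forall n, u n.+1 ^+ h.+1 <= u n ^+ h) ->
  forall eps : algC, 0 < eps ->
    exists N : nat, forall n : nat, (N <= n)%N -> `|u n - 1| < eps.
Proof.
move=> ge1_u step_u eps eps_gt0.
have u_ge0 n : 0 <= u n := le_trans ler01 (ge1_u n).
have bound_u n : u n ^+ (h.+1 ^ n) <= u 0%N ^+ (h ^ n).
  elim: n => [|n IHn]; first by rewrite !expn0.
  rewrite expnS exprM; apply: le_trans (_ : (u n ^+ h) ^+ (h.+1 ^ n) <= _).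
    by rewrite lerXn2r ?nnegrE ?exprn_ge0.
  by rewrite exprAC expnSr exprM lerXn2r ?nnegrE ?exprn_ge0.
have [K leK] : exists K : nat, u 0%N <= (1 + eps) ^+ K.
  (* By Bernoulli, any K >= u_0/eps suffices. *)
  exists (Num.bound (u 0%N / eps)).
  apply: le_trans (bernoulli _ (ltW eps_gt0)).
  rewrite -mulr_natr mulrC; apply: ler_wpDl => //.
  by rewrite -ler_pdivrMr // ltW // archi_boundP // divr_ge0 // ltW.
exists (K * h).+1 => n lt_n; rewrite ger0_norm ?subr_ge0 //.
rewrite ltrBlDl real_ltNge ?ger0_real ?addr_ge0 ?(ltW eps_gt0) //.
apply/negP=> le_un.
have gt1 : 1 < 1 + eps by rewrite ltrDl.
have := expn_contract_lt lt_n; rewrite -(ltr_eXn2l gt1) => /lt_geF/negP; apply.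
rewrite (le_trans _ (le_trans (bound_u n) _)) ?lerXn2r ?nnegrE ?addr_ge0 ?(ltW eps_gt0) //.
by rewrite exprM lerXn2r ?nnegrE ?exprn_ge0 ?addr_ge0 ?(ltW eps_gt0).
Qed.
Theorem theorem9p3 (alpha : algC) :
  (exists (N a : nat) (b : rat), 0 < b /\
     forall n : nat, (N <= n)%N -> iter n weilH alpha = natrpow a b)
  \/
  (forall eps : algC, 0 < eps ->
     exists N : nat, forall n : nat, (N <= n)%N ->
       `|iter n weilH alpha - 1| < eps).
Proof.
have [L [iota [x Dx]]] := splitting_field_exists alpha.
(* Two applications of H are needed: the first reaches a root of an integer of L, the second makes
   that integer dominate its conjugates. *)
pose u n := iter n.+2 weilH alpha.
have ge1_u n : 1 <= u n by apply: weilH_ge1.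
have state n : root_state iota (u n).
  elim: n => [|n [m [y [m_gt0 Dm int_y _]]]]; last exact: root_state_step Dm int_y.
  have [m [y [m_gt0 int_y Dm]]] := weilH_start iota x.
  by rewrite /u /= -Dx; apply: root_state_step Dm int_y.
have [[n [m [a [m_gt0 Da]]]] | not_nat] :=
  classic (exists n m a : nat, (0 < m)%N /\ u n ^+ m = a%:R).
  (* The term [u n] is the m-th root of a, hence the exponent 1/m. *)
  left; exists n.+2, a, m%:R^-1; split=> [|k le_nk]; first by rewrite invr_gt0 ltr0n.
  rewrite (natrpow_inv m_gt0 (le_trans ler01 (ge1_u n)) Da) -(subnK le_nk) iterD -/(u n).
  by elim: (k - _)%N => //= i ->; apply: weilH_root_nat Da.
right=> eps eps_gt0.
(* With h = |G| - 1, the exponents h+1 and h are those of the contraction step. *)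
have [n|N leN] := contraction_limit ge1_u _ eps_gt0 (h := #|[set: gal_of {:L}]|.-1).
  rewrite prednK ?order_gal_gt0 //.
  have [[m [a Da]] | //] := weilH_nat_or_contract (ge1_u n) (state n).
  by case: not_nat; exists n.+1, m, a.
exists N.+2 => -[|[|n]] // ltNn; exact: leN.
Qed.
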